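(* Let $S$ be a $t$-conorm, $N$ a fuzzy negation, $T$ a $t$-norm, and $N'$ a fuzzy negation. Let $I_{S,N,T}(x,y)=S(N(T(x,N(y))),N(x))$ and define $S^{N'}:[0,1]^2\to[0,1]$ by $S^{N'}(x,y)=I_{S,N,T}(N'(x),y)$. Then: (i) $S^{N'}(1,x)=S^{N'}(x,1)=1$ for all $x\in[0,1]$; (ii) $S^{N'}$ is non-decreasing in both variables; (iii) if $S=\max$, $T=\min$ and $N=N'$ is strong, then $S^{N'}$ is commutative; (iv) if $S=\max$, $T=\min$ and $N=N'$ is strong, then $S^{N'}(x,0)=x$ for all $x\in[0,1]$; (v) if $S=\max$, $T=\min$ and $N=N'$ is strong, then $S^{N'}$ is associative.
   Context: A $t$-norm is a function $T:[0,1]^2\to[0,1]$ that is commutative, associative, non-decreasing in each argument and satisfies $T(x,1)=x$. A $t$-conorm is a function $S:[0,1]^2\to[0,1]$ that is commutative, associative, non-decreasing in each argument and satisfies $S(x,0)=x$. A fuzzy negation is a non-increasing $N:[0,1]\to[0,1]$ with $N(0)=1$, $N(1)=0$; it is strong if $N(N(x))=x$ for all $x$. Here $\max$ and $\min$ denote the $t$-conorm $(x,y)\mapsto\max\{x,y\}$ and the $t$-norm $(x,y)\mapsto\min\{x,y\}$. *)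

(* Defs.v *)
From mathcomp Require Import all_boot all_order all_algebra.
From mathcomp Require Import interval_inference reals.

Set Implicit Arguments.
Unset Strict Implicit.
Unset Printing Implicit Defensive.

Import Order.TTheory GRing.Theory Num.Theory.
Local Open Scope ring_scope.

(* The unit interval [0,1] of a realType is the library type {i01 R}, ordered
   as a subtype of R; 0%:i01 and 1%:i01 are its endpoints. *)

Section FuzzyConnectives.
Variable R : realType.
Implicit Types (F S T : {i01 R} -> {i01 R} -> {i01 R}) (N : {i01 R} -> {i01 R}).

Definition nondecreasing2 F : Prop :=
  (forall y, {homo F^~ y : x1 x2 / x1 <= x2}) /\
  (forall x, {homo F x : y1 y2 / y1 <= y2}).

Record is_tnorm T : Prop := IsTnorm {
  tnormC : commutative T;
  tnormA : associative T;
  tnorm_homo : nondecreasing2 T;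
  tnormx1 : forall x, T x 1%:i01 = x
}.

Record is_tconorm S : Prop := IsTconorm {
  tconormC : commutative S;
  tconormA : associative S;
  tconorm_homo : nondecreasing2 S;
  tconormx0 : forall x, S x 0%:i01 = x
}.

Record is_fuzzy_negation N : Prop := IsFuzzyNegation {
  fuzzy_negation_homo : {homo N : x y /~ x <= y};
  fuzzy_negation0 : N 0%:i01 = 1%:i01;
  fuzzy_negation1 : N 1%:i01 = 0%:i01
}.

Definition strong_negation N : Prop := forall x, N (N x) = x.

Definition max01 (x y : {i01 R}) : {i01 R} := Num.max x y.
Definition min01 (x y : {i01 R}) : {i01 R} := Num.min x y.

Definition I_SNT S N T (x y : {i01 R}) : {i01 R} :=
  S (N (T x (N y))) (N x).

Definition S_neg S N T (N' : {i01 R} -> {i01 R}) (x y : {i01 R}) : {i01 R} :=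
  I_SNT S N T (N' x) y.

End FuzzyConnectives.
Arguments max01 {R} x y.
Arguments min01 {R} x y.

(* Main.v *)
Require Import Defs.
From mathcomp Require Import all_boot all_order all_algebra.
From mathcomp Require Import interval_inference reals.
Import Order.TTheory.
Local Open Scope ring_scope.

(** Monotonicity makes [0] absorbing for [T] and [1] absorbing for [S], which
    gives (i); (ii) is a count of the order reversals.  For (iii)-(v), a strong
    negation exchanges [min] and [max], so [S^N'] collapses to [max] itself. *)

Section FuzzyConnectivesTheory.
Variable R : realType.
Implicit Types (S T : {i01 R} -> {i01 R} -> {i01 R}) (N : {i01 R} -> {i01 R}).
Implicit Types x y : {i01 R}.

Lemma i01_ge0 x : 0%:i01 <= x.
Proof. by rewrite -num_le; exact: ge0. Qed.

Lemma i01_le1 x : x <= 1%:i01.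
Proof. by rewrite -num_le; exact: le1. Qed.

(** Monotonicity in the second argument gives [T 0 y <= T 0 1 = 0]. *)
Lemma tnorm0x T : is_tnorm T -> left_zero 0%:i01 T.
Proof.
case=> _ _ [_ Th] Tx1 y; apply/le_anti; rewrite i01_ge0 andbT.
by rewrite -[leRHS]Tx1; apply/Th/i01_le1.
Qed.

Lemma tnormx0 T : is_tnorm T -> right_zero 0%:i01 T.
Proof. by move=> HT y; rewrite (tnormC HT) tnorm0x. Qed.

(** Dually, [1 = S 1 0 <= S 1 y]. *)
Lemma tconorm1x S : is_tconorm S -> left_zero 1%:i01 S.
Proof.
case=> _ _ [_ Sh] Sx0 y; apply/le_anti; rewrite i01_le1 /=.
by rewrite -[leLHS]Sx0; apply/Sh/i01_ge0.
Qed.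

(** De Morgan law: by symmetry take [x <= y]; then [N y] is the smaller negation, and involutivity
    returns [y]. *)
Lemma strong_negation_min N : is_fuzzy_negation N -> strong_negation N ->
  forall x y, N (min01 (N x) (N y)) = max01 x y.
Proof.
move=> [Nh _ _] NK x y; rewrite /min01 /max01.
wlog le_xy : x y / x <= y => [IH|].
  by case/orP: (le_total x y) => /IH // e; rewrite minC maxC.
by rewrite (min_idPr (Nh _ _ le_xy)) NK (max_idPr le_xy).
Qed.

(** De Morgan turns the first argument of [S] into [max01 x y], involutivity turns the second into
    [x], and idempotence absorbs the repeated [x]. *)
Lemma S_neg_max S N T N' :
  is_fuzzy_negation N' -> S =2 max01 -> T =2 min01 -> N =1 N' ->
  strong_negation N' -> S_neg S N T N' =2 max01.
Proof.
move=> HN' eS eT eN NK x y; rewrite /S_neg /I_SNT eS eT !eN NK.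
by rewrite strong_negation_min // /max01 maxC maxA maxxx.
Qed.

Lemma S_neg_nondecreasing S N T N' :
  is_tconorm S -> is_fuzzy_negation N -> is_tnorm T -> is_fuzzy_negation N' ->
  nondecreasing2 (S_neg S N T N').
Proof.
move=> [_ _ [Sl Sr] _] [Nh _ _] [_ _ [Tl Tr] _] [N'h _ _].
split=> [y x1 x2 | x y1 y2] le12; rewrite /S_neg /I_SNT.
  (* The first variable feeds both arguments of [S], so [x1] is replaced by [x2] in one argument at
     a time; each occurrence sits under one [N] and one [N'], so the two reversals cancel. *)
  apply: (@le_trans _ _ (S (N (T (N' x2) (N y))) (N (N' x1)))).
    by apply/Sl/Nh/Tl/N'h.
  by apply/Sr/Nh/N'h.
by apply/Sl/Nh/Tr/Nh.
Qed.

End FuzzyConnectivesTheory.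

Theorem theorem3p2 (R : realType)
    (S : {i01 R} -> {i01 R} -> {i01 R}) (N : {i01 R} -> {i01 R})
    (T : {i01 R} -> {i01 R} -> {i01 R}) (N' : {i01 R} -> {i01 R})
    (HS : is_tconorm S) (HN : is_fuzzy_negation N)
    (HT : is_tnorm T) (HN' : is_fuzzy_negation N') :
  (forall x, S_neg S N T N' 1%:i01 x = 1%:i01 /\
             S_neg S N T N' x 1%:i01 = 1%:i01) /\
  nondecreasing2 (S_neg S N T N') /\
  (S =2 max01 -> T =2 min01 -> N =1 N' -> strong_negation N' ->
     commutative (S_neg S N T N')) /\
  (S =2 max01 -> T =2 min01 -> N =1 N' -> strong_negation N' ->
     forall x, S_neg S N T N' x 0%:i01 = x) /\
  (S =2 max01 -> T =2 min01 -> N =1 N' -> strong_negation N' ->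
     associative (S_neg S N T N')).
Proof.
split; [|split; [exact: S_neg_nondecreasing|split; [|split]]].
- move=> x; rewrite /S_neg /I_SNT; split.
    (* In either position, [1] is negated to [0], which annihilates [T]; the outer [N] then yields
       [1], which annihilates [S]. *)
    by rewrite (fuzzy_negation1 HN') tnorm0x // (fuzzy_negation0 HN) tconorm1x.
  by rewrite (fuzzy_negation1 HN) tnormx0 // (fuzzy_negation0 HN) tconorm1x.
- by move=> eS eT eN NK x y; rewrite !S_neg_max // /max01 maxC.
- move=> eS eT eN NK x; rewrite S_neg_max // /max01.
  exact/max_idPl/i01_ge0.
- by move=> eS eT eN NK x y z; rewrite !S_neg_max // /max01 maxA.
Qed.
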